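(* Let $\mathcal{M}=(M,g)$ be a pseudo-Riemannian manifold with curvature tensor $R$ and Ricci operator $\rho$. The following assertions are equivalent: (1) $R(\rho\xi_1,\xi_2,\xi_3,\xi_4)=R(\xi_1,\rho\xi_2,\xi_3,\xi_4)=R(\xi_1,\xi_2,\rho\xi_3,\xi_4)=R(\xi_1,\xi_2,\xi_3,\rho\xi_4)$ for all points $P\in M$ and all $\xi_1,\xi_2,\xi_3,\xi_4\in T_PM$. (2) $\mathcal{M}$ is skew--Videv. (3) $\mathcal{M}$ is Jacobi--Videv.
   Context: Let $\nabla$ be the Levi-Civita connection of $(M,g)$, $\mathcal{R}(x,y)=\nabla_x\nabla_y-\nabla_y\nabla_x-\nabla_{[x,y]}$ the curvature operator, $R(x,y,z,w)=g(\mathcal{R}(x,y)z,w)$ the curvature tensor, and $\mathcal{J}(x):y\mapsto\mathcal{R}(y,x)x$ the Jacobi operator. The polarized Jacobi operator is $\mathcal{J}(x_1,x_2):y\mapsto\frac12\{\mathcal{R}(y,x_1)x_2+\mathcal{R}(y,x_2)x_1\}$. The Ricci form is $\rho(x_1,x_2)=\operatorname{Tr}\{\mathcal{J}(x_1,x_2)\}$, and the Ricci operator $\rho$ is the self-adjoint endomorphism with $g(\rho x_1,x_2)=\rho(x_1,x_2)$. $\mathcal{M}$ is Jacobi--Videv if $\mathcal{J}(x)\rho=\rho\mathcal{J}(x)$ for all tangent vectors $x$ (at every point). $\mathcal{M}$ is skew--Videv if $\mathcal{R}(x,y)\rho=\rho\mathcal{R}(x,y)$ for all tangent vectors $x,y$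 at the same point, for every point. *)

(* Defs.v *)
From HB Require Import structures.
From mathcomp Require Import all_boot all_order all_algebra.
From mathcomp Require Import all_classical all_reals all_analysis.

Set Implicit Arguments.
Unset Strict Implicit.
Unset Printing Implicit Defensive.

Import Order.TTheory GRing.Theory Num.Theory.
Import numFieldNormedType.Exports.

Local Open Scope classical_set_scope.
Local Open Scope ring_scope.

(* [Ck_on k A f] and [smooth_on A f] are only meaningful for [A] open, and then
   depend on [f] only through its restriction to [A].  For V of finite dimension
   this is the usual notion: f is C^(k+1) iff it is differentiable and all its
   directional derivatives are C^k. *)
Fixpoint Ck_on (R : realType) (V W : normedModType R) (k : nat) (A : set V)
    (f : V -> W) : Prop :=
  match k with
  | 0 => forall x, A x -> {for x, continuous f}
  | k'.+1 => (forall x, A x -> differentiable f x) /\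
             (forall v : V, Ck_on k' A ('D_v f))
  end.

Definition smooth_on (R : realType) (V W : normedModType R) (A : set V)
    (f : V -> W) : Prop :=
  forall k, Ck_on k A f.

(* Both [chart_map] and [chart_inv] are total functions; their values outside
   [chart_dom] and outside its image are irrelevant. *)
Record chart (R : realType) (n : nat) (M : topologicalType) := Chart {
  chart_dom : set M;
  chart_map :> M -> 'rV[R]_n;
  chart_inv : 'rV[R]_n -> M;
  chart_dom_open : open chart_dom;
  chart_cod_open : open (chart_map @` chart_dom);
  chart_mapK : forall p, chart_dom p -> chart_inv (chart_map p) = p;
  chart_map_continuous :
    forall p, chart_dom p -> {for p, continuous chart_map};
  chart_inv_continuous :
    forall p, chart_dom p -> {for chart_map p, continuous chart_inv}
}.

Record manifold (R : realType) (n : nat) := Manifold {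
  mfd_space :> topologicalType;
  mfd_hausdorff : hausdorff_space mfd_space;
  mfd_second_countable : @second_countable mfd_space;
  atlas : set (chart R n mfd_space);
  atlas_smooth : forall c d, atlas c -> atlas d ->
    smooth_on (c @` (chart_dom c `&` chart_dom d)) (d \o chart_inv c);
  (* a distinguished chart around each point *)
  chart_at : mfd_space -> chart R n mfd_space;
  chart_at_atlas : forall p, atlas (chart_at p);
  chart_at_dom : forall p, chart_dom (chart_at p) p
}.

(* The tangent space T_pM is represented by 'rV[R]_n: a tangent vector at p is
   given by its components in the distinguished chart [chart_at p].  Its
   components in another chart c around p are obtained by applying the
   differential of the transition map, [to_chart c p]; the inverse isomorphism
   is [of_chart c p].  A vector field is thus a map M -> 'rV[R]_n whose value at
   p is read in [chart_at p]. *)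
Section Manifold.
Variables (R : realType) (n : nat) (M : manifold R n).

Definition vfield := M -> 'rV[R]_n.

Implicit Types (c : chart R n M) (p : M) (U : set M) (X Y Z : vfield)
  (f : M -> R).

Definition to_chart c p : 'rV[R]_n -> 'rV[R]_n :=
  'd (c \o chart_inv (chart_at p)) (chart_at p p).

Definition of_chart c p : 'rV[R]_n -> 'rV[R]_n :=
  'd (chart_at p \o chart_inv c) (c p).

Definition local_rep c X : 'rV[R]_n -> 'rV[R]_n :=
  fun u => to_chart c (chart_inv c u) (X (chart_inv c u)).

Definition smooth_fun U f : Prop :=
  forall c, atlas c -> smooth_on (c @` (chart_dom c `&` U)) (f \o chart_inv c).

Definition smooth_vfield U X : Prop :=
  forall c, atlas c -> smooth_on (c @` (chart_dom c `&` U)) (local_rep c X).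

(* X(f) *)
Definition lie_derive X f : M -> R :=
  fun p => 'd (f \o chart_inv (chart_at p)) (chart_at p p) (X p).

(* [X, Y]^j = \sum_i (X^i d_i Y^j - Y^i d_i X^j) in the chart at p *)
Definition lie_bracket X Y : vfield :=
  fun p => let c := chart_at p in
    'd (local_rep c Y) (c p) (X p) - 'd (local_rep c X) (c p) (Y p).

(* The local extension of the tangent vector x at p with constant components in
   the chart at p; it is a smooth vector field on the domain of that chart. *)
Definition extend p (x : 'rV[R]_n) : vfield :=
  fun q => of_chart (chart_at p) q x.

(* A connection is a local operator, so it acts on the smooth vector fields of
   every open subset U of M.  Here it is a single operator on all maps
   M -> 'rV[R]_n subject to the axioms over every U; that the restriction of
   [nabla X Y] to U depends only on the restrictions of X and Y follows from
   the two Leibniz-type axioms, applied to functions vanishing on U. *)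
Record is_connection (nabla : vfield -> vfield -> vfield) : Prop := {
  nabla_smooth : forall U X Y, open U ->
    smooth_vfield U X -> smooth_vfield U Y -> smooth_vfield U (nabla X Y);
  nablaDl : forall U X X' Y, open U ->
    smooth_vfield U X -> smooth_vfield U X' -> smooth_vfield U Y ->
    forall p, U p -> nabla (fun q => X q + X' q) Y p = nabla X Y p + nabla X' Y p;
  nablaZl : forall U f X Y, open U ->
    smooth_fun U f -> smooth_vfield U X -> smooth_vfield U Y ->
    forall p, U p -> nabla (fun q => f q *: X q) Y p = f p *: nabla X Y p;
  nablaDr : forall U X Y Y', open U ->
    smooth_vfield U X -> smooth_vfield U Y -> smooth_vfield U Y' ->
    forall p, U p -> nabla X (fun q => Y q + Y' q) p = nabla X Y p + nabla X Y' p;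
  nabla_Leibniz : forall U f X Y, open U ->
    smooth_fun U f -> smooth_vfield U X -> smooth_vfield U Y ->
    forall p, U p ->
      nabla X (fun q => f q *: Y q) p =
      lie_derive X f p *: Y p + f p *: nabla X Y p
}.

End Manifold.

(* [gram p] is the Gram matrix of g at p in the components of T_pM. *)
Record pseudo_riemannian (R : realType) (n : nat) := PseudoRiemannian {
  prm_mfd :> manifold R n;
  gram : prm_mfd -> 'M[R]_n;
  gram_sym : forall p, (gram p)^T = gram p;
  gram_nondegenerate : forall p, gram p \in unitmx;
  gram_smooth : forall c, atlas c -> forall x y : 'rV[R]_n,
    smooth_on (c @` chart_dom c)
      (fun u => let p := chart_inv c u in
        (of_chart c p x *m gram p *m (of_chart c p y)^T) 0 0)
}.

Section PseudoRiemannian.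
Variables (R : realType) (n : nat) (M : pseudo_riemannian R n).

Definition metric (p : M) (x y : 'rV[R]_n) : R := (x *m gram p *m y^T) 0 0.

Record is_levi_civita (nabla : vfield M -> vfield M -> vfield M) : Prop := {
  lc_connection : is_connection nabla;
  lc_torsion_free : forall (U : set M) (X Y : vfield M), open U ->
    smooth_vfield U X -> smooth_vfield U Y ->
    forall p, U p -> nabla X Y p - nabla Y X p = lie_bracket X Y p;
  lc_metric : forall (U : set M) (X Y Z : vfield M), open U ->
    smooth_vfield U X -> smooth_vfield U Y -> smooth_vfield U Z ->
    forall p, U p ->
      lie_derive X (fun q => metric q (Y q) (Z q)) p =
      metric p (nabla X Y p) (Z p) + metric p (Y p) (nabla X Z p)
}.

Variable nabla : vfield M -> vfield M -> vfield M.

Definition curvature_vfield (X Y Z : vfield M) : vfield M :=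
  fun p => nabla X (nabla Y Z) p - nabla Y (nabla X Z) p
           - nabla (lie_bracket X Y) Z p.

(* By tensoriality the value does not depend on the local extensions chosen. *)
Definition curvature_op (p : M) (x y z : 'rV[R]_n) : 'rV[R]_n :=
  curvature_vfield (extend p x) (extend p y) (extend p z) p.

Definition curvature (p : M) (x y z w : 'rV[R]_n) : R :=
  metric p (curvature_op p x y z) w.

Definition jacobi_op (p : M) (x y : 'rV[R]_n) : 'rV[R]_n :=
  curvature_op p y x x.

Definition polarized_jacobi_op (p : M) (x1 x2 y : 'rV[R]_n) : 'rV[R]_n :=
  2^-1 *: (curvature_op p y x1 x2 + curvature_op p y x2 x1).

Definition ricci_form (p : M) (x1 x2 : 'rV[R]_n) : R :=
  \tr (lin1_mx (polarized_jacobi_op p x1 x2)).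

Definition is_ricci_operator (rho : M -> {linear 'rV[R]_n -> 'rV[R]_n}) : Prop :=
  forall p x1 x2, metric p (rho p x1) x2 = ricci_form p x1 x2.

Definition jacobi_videv (rho : M -> {linear 'rV[R]_n -> 'rV[R]_n}) : Prop :=
  forall p x y, jacobi_op p x (rho p y) = rho p (jacobi_op p x y).

Definition skew_videv (rho : M -> {linear 'rV[R]_n -> 'rV[R]_n}) : Prop :=
  forall p x y z, curvature_op p x y (rho p z) = rho p (curvature_op p x y z).

End PseudoRiemannian.

(* Main.v *)
Require Import Defs.
From HB Require Import structures.
From mathcomp Require Import all_boot all_order all_algebra.
From mathcomp Require Import all_classical all_reals all_analysis.
From mathcomp Require Import ring lra.

Set Implicit Arguments.
Unset Strict Implicit.
Unset Printing Implicit Defensive.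

Import Order.TTheory GRing.Theory Num.Theory.
Import numFieldNormedType.Exports.

Local Open Scope ring_scope.

(** The theorem is pointwise linear algebra once the symmetries of the curvature
    tensor are available.

    The Ricci form is symmetric, so the Ricci operator rho is self-adjoint, and
    since the metric is nondegenerate, commuting with rho can be read off the
    curvature tensor: the manifold is skew-Videv iff rho can be moved from the
    third to the fourth slot of R ([skew_videvP]), and Jacobi-Videv iff it can
    be moved from y to w in R(y, x, x, w) ([jacobi_videvP]).  Assertion (1)
    clearly gives both.  The converses hold for every map r in place of rho and
    every algebraic curvature tensor, and combine instances of the Bianchi
    identity in which r sits on different vectors ([slides_through_skew],
    [slides_through_jacobi]).

    The symmetries of R come from evaluating it on the coordinate fields of the
    distinguished chart at p, which are what [extend p] produces.  Their
    brackets are mixed second derivatives of a transition map minus the same in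
    the other order, so they vanish by Schwarz's theorem ([schwarz],
    [lie_bracket_extend]).  A connection is a local operator ([nabla_locall],
    [nabla_localr]), hence R(x, y)z is the commutator of the covariant
    derivatives along X and Y applied to Z ([curvature_opE]).  The first Bianchi
    identity is then torsion-freeness, and R(x, y, z, z) = 0 is the commutation
    of the second derivatives of the function g(Z, Z) in the chart
    ([curvature_alternating]).  That coordinate fields are smooth requires C^k
    functions to be closed under composition ([Ck_on_comp]). *)

(** * C^k functions on open sets *)

Section SmoothFunctions.
Local Open Scope classical_set_scope.
Variable R : realType.
Implicit Types U V W : normedModType R.

Lemma near_eq_diff V W (f g : V -> W) a : {near a, f =1 g} ->
  differentiable f a -> differentiable g a /\ forall v, 'd g a v = 'd f a v.
Proof.
move=> fg df; have ga : f a = g a by exact: nbhs_singleton fg.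
have dfc : continuous ('d f a) by exact: diff_continuous.
have g_exp : g \o shift a = cst (g a) + 'd f a +o_ 0 id.
  apply/eqaddoP => e e0.
  have /eqaddoP /(_ e e0) := diff_locally df.
  have fg0 : \forall h \near (0 : V), f (h + a) = g (h + a).
    by move: fg; rewrite [in X in X -> _](near_shift 0) subr0.
  apply: filter_app; near=> h.
  rewrite -![(_ + _ : _ -> _) _]/(_ + _) -![(- _ : _ -> _) _]/(- _) /=.
  by rewrite ga (near fg0 h).
have gE : 'd g a = 'd f a :> (V -> W) by exact: diff_unique.
split; last by move=> v; exact: (congr1 (fun h : V -> W => h v) gE).
by apply/diff_locallyP; rewrite gE.
Unshelve. all: by end_near. Qed.

(** Scalar multiplication is bilinear and continuous, so the Leibniz rule is its
    differential precomposed with the pair of both functions. *)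
Lemma is_diff_scale V W (k dk : V -> R) (f df : V -> W) a :
  is_diff a k dk -> is_diff a f df ->
  is_diff a (fun x => k x *: f x) (fun v => k a *: df v + dk v *: f a).
Proof.
move=> dka dfa; pose scale (x : R) (y : W) := x *: y.
have scale_bilin : bilinear_for
    (GRing.Scale.Law.clone _ _ *:%R _) (GRing.Scale.Law.clone _ _ *:%R _) scale.
  split=> [y|x] b u v; rewrite /scale /=; first by rewrite scalerDl scalerA.
  by rewrite scalerDr !scalerA mulrC.
pose scaleM := bilinear_isBilinear.Build R R W W _ _ scale scale_bilin.
pose scaleB : {bilinear R -> W -> W} := HB.pack scale scaleM.
have scale_cont : continuous (fun p : R * W => scaleB p.1 p.2).
  exact: scale_continuous.
have dscale : is_diff (k a, f a) (fun p : R * W => scaleB p.1 p.2)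
    (fun p => scaleB (k a) p.2 + scaleB p.1 (f a)).
  apply: DiffDef; first exact: differentiable_bilin.
  by rewrite (diff_bilin _ scale_cont).
exact: (@is_diff_comp _ _ _ _ (fun y => (k y, f y)) _ _ _ a _ dscale).
Qed.

Lemma Ck_on_sub V W k (A B : set V) (f : V -> W) :
  A `<=` B -> Ck_on k B f -> Ck_on k A f.
Proof.
move=> AB; elim: k f => [|k IH] f /=; first by move=> fB x /AB/fB.
by move=> [df Df]; split=> [x /AB/df //|v]; exact: IH.
Qed.

Lemma Ck_on_congr V W k (A : set V) (f g : V -> W) : open A ->
  {in A, f =1 g} -> Ck_on k A f -> Ck_on k A g.
Proof.
move=> Aopen.
have fgA (f1 g1 : V -> W) x :
    {in A, f1 =1 g1} -> A x -> {near x, f1 =1 g1}.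
  move=> fg Ax; have Anx : nbhs x A by exact: open_nbhs_nbhs.
  by apply: filterS Anx => y Ay; apply: fg; rewrite inE.
elim: k f g => [|k IH] f g fg /=.
  move=> fc x Ax; rewrite /prop_for /continuous_at -(fg x) ?inE//.
  by apply: cvg_trans (fc x Ax); apply: near_eq_cvg; exact: fgA fg Ax.
move=> [df Df]; split=> [x Ax|v].
  by case: (near_eq_diff (fgA _ _ _ fg Ax) (df x Ax)).
apply: IH (Df v) => x; rewrite inE => Ax.
by apply: near_eq_derive; exact: fgA.
Qed.

Lemma Ck_onW V W k (A : set V) (f : V -> W) : Ck_on k.+1 A f -> Ck_on k A f.
Proof.
elim: k f => [|k IH] f [df Df] /=.
  by move=> x Ax; exact/differentiable_continuous/df.
by split=> // v; apply: IH; exact: Df.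
Qed.

Lemma Ck_on_cst V W k (A : set V) (w : W) : Ck_on k A (fun=> w).
Proof.
elim: k w => [|k IH] w /=; first by move=> x _; exact: cst_continuous.
split=> [x _|v]; first exact: differentiable_cst.
rewrite (_ : 'D_v _ = fun=> 0) //; apply/funext => x; exact: derive_cst.
Qed.

Lemma Ck_onD V W k (A : set V) (f g : V -> W) : open A ->
  Ck_on k A f -> Ck_on k A g -> Ck_on k A (fun x => f x + g x).
Proof.
move=> Aopen; elim: k f g => [|k IH] f g /=.
  by move=> fc gc x Ax; apply: cvgD; [exact: fc|exact: gc].
move=> [df Df] [dg Dg]; split=> [x Ax|v].
  by apply: differentiableD; [exact: df|exact: dg].
apply: Ck_on_congr (IH _ _ (Df v) (Dg v)) => // x; rewrite inE => Ax.
by rewrite deriveD //; apply: diff_derivable; [exact: df|exact: dg].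
Qed.

Lemma Ck_on_sum V W k (A : set V) (I : Type) (s : seq I) (f : I -> V -> W) :
  open A -> (forall i, Ck_on k A (f i)) -> Ck_on k A (fun x => \sum_(i <- s) f i x).
Proof.
move=> Aopen fk; elim: s => [|i s IH].
  rewrite (_ : (fun _ => _) = fun=> 0); first exact: Ck_on_cst.
  by apply/funext => x; rewrite big_nil.
rewrite (_ : (fun _ => _) = fun x => f i x + \sum_(i <- s) f i x).
  exact: Ck_onD.
by apply/funext => x; rewrite big_cons.
Qed.

Lemma Ck_on_scale V W k (A : set V) (a : V -> R) (f : V -> W) : open A ->
  Ck_on k A a -> Ck_on k A f -> Ck_on k A (fun x => a x *: f x).
Proof.
move=> Aopen; elim: k a f => [|k IH] a f ka kf.
  by move=> x Ax; apply: cvgZ; [exact: ka|exact: kf].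
have [[da Da] [df Df]] := (ka, kf).
have daf x (Ax : A x) :=
  is_diff_scale (differentiableP (da x Ax)) (differentiableP (df x Ax)).
split=> [x /daf//|v].
have Dk := Ck_onD Aopen (IH _ _ (Ck_onW ka) (Df v)) (IH _ _ (Da v) (Ck_onW kf)).
apply: Ck_on_congr Dk => // x; rewrite inE => Ax; have ? := daf x Ax.
by rewrite [RHS]deriveE // diff_val !deriveE //; [exact: da|exact: df].
Qed.

Lemma Ck_on_coord V k m (A : set V) (f : V -> 'rV[R]_m) i :
  open A -> Ck_on k A f -> Ck_on k A (fun x => f x 0 i).
Proof.
move=> Aopen; elim: k f => [|k IH] f /=.
  move=> fc x Ax; apply: (@continuous_comp _ _ _ f (fun y : 'rV_m => y 0 i)).
    exact: fc.
  exact: coord_continuous.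
move=> [df Df]; split=> [x Ax|v].
  apply: (@differentiable_comp _ _ _ _ f (fun y : 'rV_m => y 0 i)); first exact: df.
  exact: differentiable_coord.
apply: Ck_on_congr (IH _ (Df v)) => // x; rewrite inE => Ax.
by rewrite derive_mx ?mxE //; apply: diff_derivable; exact: df.
Qed.

Lemma diff_coord_sum m W (f : 'rV[R]_m -> W) x w :
  'd f x w = \sum_(i < m) w 0 i *: 'd f x (delta_mx 0 i).
Proof.
rewrite {1}[w]row_sum_delta linear_sum.
by apply: eq_bigr => i _; rewrite linearZ.
Qed.

(** Expanding the chain rule along the standard basis, the derivative of f \o g
    in the direction v is the sum of the coordinates of D_v g times the
    composites of the partial derivatives of f with g, so that induction on k
    only has to deal with products and sums. *)
Lemma Ck_on_comp V W k m (A : set V) (B : set 'rV[R]_m)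
    (f : 'rV[R]_m -> W) (g : V -> 'rV[R]_m) : open A -> g @` A `<=` B ->
  Ck_on k B f -> Ck_on k A g -> Ck_on k A (f \o g).
Proof.
move=> Aopen gAB; elim: k f g gAB => [|k IH] f g gAB fB gA.
  move=> x Ax; apply: continuous_comp; first exact: gA.
  by apply: fB; apply: gAB; exists x.
have [[df Df] [dg Dg]] := (fB, gA).
have dfg x : A x -> differentiable f (g x).
  by move=> Ax; apply: df; apply: gAB; exists x.
split=> [x Ax|v].
  by apply: differentiable_comp; [exact: dg|exact: dfg].
have sumk : Ck_on k A (fun x => \sum_(i < m)
    ('D_v g x) 0 i *: ('D_(delta_mx 0 i) f \o g) x).
  apply: Ck_on_sum => // i; apply: Ck_on_scale => //.
    by apply: Ck_on_coord => //; exact: Dg.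
  by apply: IH => //; [exact: Df|exact: Ck_onW].
apply: Ck_on_congr sumk => // x; rewrite inE => Ax.
have dgx := dg x Ax; have dfgx := dfg x Ax.
have dfgg : differentiable (f \o g) x by exact: differentiable_comp.
rewrite [RHS]deriveE // diff_comp //= diff_coord_sum deriveE//.
by apply: eq_bigr => i _; rewrite /= deriveE.
Qed.

(** The point b is kept abstract because in the applications f a is a composite
    of a chart map with the inverse of another, which equals b only by a proof
    and not by computation. *)
Lemma diff_compE U V W (f : U -> V) (g : V -> W) a b v : f a = b ->
  differentiable f a -> differentiable g b ->
  differentiable (g \o f) a /\ 'd (g \o f) a v = 'd g b ('d f a v).
Proof.
move=> <- df dg; split; first exact: differentiable_comp.
by rewrite diff_comp.
Qed.

End SmoothFunctions.

(** * Symmetry of second derivatives *)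

Section SecondDerivatives.
Local Open Scope classical_set_scope.
Variable R : realType.
Implicit Types V W : normedModType R.

Lemma is_derive_line V W (f : V -> W) b v t : differentiable f (b + t *: v) ->
  is_derive t (1 : R) (fun s : R => f (b + s *: v)) ('D_v f (b + t *: v)).
Proof.
move=> df; have dl : is_diff t (fun s : R => b + s *: v) (fun h => h *: v).
  by apply: is_diff_eq; apply/funext => h /=; rewrite add0r.
have dfl := @is_diff_comp _ _ _ _ _ _ _ _ _ dl (differentiableP df).
have dfd : differentiable (fun s : R => f (b + s *: v)) t.
  exact: (@ex_diff _ _ _ _ _ _ _ dfl).
apply: DeriveDef; first exact: diff_derivable.
rewrite !deriveE // (@diff_val _ _ _ _ _ _ _ dfl) /=; by rewrite scale1r.
Qed.

Lemma MVT_line V (f : V -> R) b v h : 0 < h ->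
  (forall s, 0 <= s <= h -> differentiable f (b + s *: v)) ->
  exists2 s, 0 <= s <= h & f (b + h *: v) - f b = 'D_v f (b + s *: v) * h.
Proof.
move=> h0 df.
have [||s sh E] := @MVT_segment R (fun s : R => f (b + s *: v))
    (fun s : R => 'D_v f (b + s *: v)) 0 h (ltW h0).
- move=> s; rewrite in_itv /= => /andP[s0 sh]; apply: is_derive_line.
  by apply: df; rewrite !ltW.
- apply: continuous_in_subspaceT => s; rewrite inE /= in_itv /= => sh.
  apply: differentiable_continuous; apply/derivable1_diffP.
  by have [] := is_derive_line (df s sh).
- by exists s => //; move: E; rewrite scale0r addr0 subr0.
Qed.

(** The mean value theorem in the direction v for the increment of f along h w,
    then in the direction w for D_v f. *)
Lemma second_difference V (f : V -> R) (A : set V) (a v w : V) h : 0 < h ->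
  Ck_on 2 A f ->
  (forall s t, 0 <= s <= h -> 0 <= t <= h -> A (a + s *: v + t *: w)) ->
  exists s t, [/\ 0 <= s <= h, 0 <= t <= h &
    f (a + h *: v + h *: w) - f (a + h *: v) - (f (a + h *: w) - f a) =
    'D_w ('D_v f) (a + s *: v + t *: w) * h * h].
Proof.
move=> h0 [df Df] hA; pose F x := f (x + h *: w) - f x.
have h00 : 0 <= (0 : R) <= h by rewrite lexx ltW.
have hh : 0 <= h <= h by rewrite lexx ltW.
have isF s : 0 <= s <= h -> is_diff (a + s *: v) F
    (fun u => 'd f (a + s *: v + h *: w) u - 'd f (a + s *: v) u).
  move=> sh.
  have d0 : differentiable f (a + s *: v).
    by apply: df; have := hA s 0 sh h00; rewrite scale0r addr0.
  have d1 : differentiable f (a + s *: v + h *: w) by apply: df; exact: hA.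
  have ds : is_diff (a + s *: v) (fun x => x + h *: w) id.
    by apply: is_diff_eq; apply/funext => u /=; rewrite addr0.
  have dfs := @is_diff_comp _ _ _ _ _ _ _ _ _ ds (differentiableP d1).
  exact: (is_diffB dfs (differentiableP d0)).
have [s sh] : exists2 s, 0 <= s <= h & F (a + h *: v) - F a =
    'D_v F (a + s *: v) * h.
  by apply: MVT_line => // s sh; have [] := isF s sh.
have dF := isF s sh.
rewrite deriveE; last by case: dF.
have d0 : differentiable f (a + s *: v).
  by apply: df; have := hA s 0 sh h00; rewrite scale0r addr0.
have d1 : differentiable f (a + s *: v + h *: w) by apply: df; exact: hA.
rewrite diff_val -!deriveE // => E.
have [|t th Et] := @MVT_line _ ('D_v f) (a + s *: v) w h h0.
  by move=> t th; have [+ _] := Df v; apply; exact: hA.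
by exists s, t; split=> //; rewrite -Et -E /F; congr (_ - _); rewrite addrAC.
Qed.

(** The second difference of f is symmetric in v and w, so evaluating it in
    both orders equates the two mixed derivatives, at two possibly different
    points of any given neighborhood of a. *)
Lemma schwarz_near V (f : V -> R) (A : set V) (a v w : V) : nbhs a A ->
  Ck_on 2 A f -> exists x y, [/\ A x, A y & 'D_w ('D_v f) x = 'D_v ('D_w f) y].
Proof.
move=> /nbhs_ballP[e /= e0 eA] fA.
(* this size keeps the parallelogram spanned by h v and h w in the ball *)
pose h := e / (`|v| + `|w| + 1).
have d0 : 0 < `|v| + `|w| + 1 by rewrite ltr_wpDl// addr_ge0.
have h0 : 0 < h by rewrite divr_gt0.
have hA s t : 0 <= s <= h -> 0 <= t <= h -> A (a + s *: v + t *: w).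
  move=> /andP[s0 sh] /andP[t0 th]; apply: eA; rewrite -ball_normE /=.
  rewrite -addrA opprD addNKr normrN (le_lt_trans (ler_normD _ _))//.
  rewrite !normrZ !ger0_norm//.
  apply: (@le_lt_trans _ _ (h * (`|v| + `|w|))).
    by rewrite mulrDr lerD // ler_wpM2r.
  by rewrite /h mulrAC ltr_pdivrMr // ltr_pM2l // ltrDl.
have [s [t [sh th E]]] := second_difference h0 fA hA.
have [|t' [s' [th' sh' E']]] := @second_difference _ f A a w v h h0 fA.
  by move=> t' s' th' sh'; rewrite addrAC; exact: hA.
exists (a + s *: v + t *: w), (a + t' *: w + s' *: v); split; first exact: hA.
  by rewrite addrAC; exact: hA.
have hn0 : h != 0 by rewrite gt_eqF.
apply: (mulIf hn0); apply: (mulIf hn0).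
apply: etrans (esym E) _; apply: etrans E'.
by rewrite (addrAC a) !opprB; ring.
Qed.

Lemma schwarz_scalar V (f : V -> R) (A : set V) (a v w : V) : open A -> A a ->
  Ck_on 2 A f -> 'D_w ('D_v f) a = 'D_v ('D_w f) a.
Proof.
move=> Aopen Aa fA; have Anbhs : nbhs a A by exact: open_nbhs_nbhs.
have cont u1 u2 : {for a, continuous ('D_u1 ('D_u2 f))}.
  by have [_ /(_ u2)[_ /(_ u1)]] := fA; apply.
apply/eqP; rewrite -subr_eq0 -normr_eq0 eq_le normr_ge0 andbT leNgt; apply/negP => e0.
set e := `|_| in e0.
have e20 : 0 < e / 2 by rewrite divr_gt0.
have /cvgrPdist_lt /(_ _ e20) c1 := cont w v.
have /cvgrPdist_lt /(_ _ e20) c2 := cont v w.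
have [|x [y [[_ [x1 _]] [_ [_ y2]] E]]] :=
  @schwarz_near _ f _ a v w (filterI Anbhs (filterI c1 c2)).
  by apply: Ck_on_sub fA; exact: subIsetl.
have : e < e; last by rewrite ltxx.
rewrite [X in _ < X]splitr /e; apply: le_lt_trans (ltrD x1 y2).
by rewrite [X in _ <= _ + X]distrC E; exact: ler_distD.
Qed.

Lemma schwarz V m (f : V -> 'rV[R]_m) (A : set V) (a v w : V) : open A -> A a ->
  Ck_on 2 A f -> 'D_w ('D_v f) a = 'D_v ('D_w f) a.
Proof.
move=> Aopen Aa fA; apply/rowP => i.
have [df Df] := fA.
have D1 u x : A x -> ('D_u f x) 0 i = 'D_u (fun y => f y 0 i) x.
  by move=> Ax; rewrite derive_mx ?mxE //; apply: diff_derivable; exact: df.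
have D2 u1 u2 : ('D_u1 ('D_u2 f) a) 0 i = 'D_u1 ('D_u2 (fun y => f y 0 i)) a.
  rewrite derive_mx ?mxE; last first.
    by apply: diff_derivable; have [+ _] := Df u2; apply.
  apply: near_eq_derive.
  by apply: filterS (open_nbhs_nbhs (conj Aopen Aa)) => x; exact: D1.
have fiA : Ck_on 2 A (fun x => f x 0 i) by exact: Ck_on_coord.
by apply: etrans (D2 w v) _; apply: etrans (esym (D2 v w));
  exact: (schwarz_scalar v w Aopen Aa fiA).
Qed.

End SecondDerivatives.

(** * Charts and coordinate fields *)

Section Charts.
Local Open Scope classical_set_scope.
Variables (R : realType) (n : nat) (M : manifold R n).
Implicit Types (c d : chart R n M) (p q : M) (U : set M) (X Y : vfield M).

Lemma chart_image_open c U : open U -> open (c @` (chart_dom c `&` U)).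
Proof.
move=> Uopen; rewrite openE => _ [p [cp Up] <-]; rewrite /interior.
have cod : nbhs (c p) (c @` chart_dom c).
  by apply: open_nbhs_nbhs; split; [exact: chart_cod_open|exists p].
have inU : nbhs (c p) (chart_inv c @^-1` U).
  apply: (chart_inv_continuous cp); rewrite chart_mapK //.
  exact: open_nbhs_nbhs.
apply: filterS (filterI cod inU) => _ [[q cq <-]].
by rewrite /preimage /= chart_mapK // => Uq; exists q.
Qed.

Lemma near_chart c p U : open U -> chart_dom c p -> U p ->
  \forall u \near c p, (c @` (chart_dom c `&` U)) u.
Proof.
move=> Uopen cp Up; apply: open_nbhs_nbhs.
by split; [exact: chart_image_open|exists p].
Qed.

Lemma differentiable_transition c d p : atlas c -> atlas d ->
  chart_dom c p -> chart_dom d p -> differentiable (d \o chart_inv c) (c p).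
Proof.
move=> ac ad cp dp; have [+ _] := atlas_smooth ac ad 1%N.
by apply; exists p.
Qed.

(** Differentials of maps on M read in two charts are related by the
    differential of the transition map: this is what makes the representation
    of tangent vectors by components coherent. *)
Lemma diff_change_chart (W : normedModType R) (f : M -> W) c d p :
  atlas c -> atlas d -> chart_dom c p -> chart_dom d p ->
  differentiable (f \o chart_inv d) (d p) ->
  forall v, 'd (f \o chart_inv c) (c p) v =
    'd (f \o chart_inv d) (d p) ('d (d \o chart_inv c) (c p) v).
Proof.
move=> ac ad cp dp df v; have dcd := differentiable_transition ac ad cp dp.
have ccp : (d \o chart_inv c) (c p) = d p by rewrite /= chart_mapK.
have [dcomp compE] := diff_compE v ccp dcd df.
have fE : {near c p, (f \o chart_inv d) \o (d \o chart_inv c) =1 f \o chart_inv c}.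
  apply: filterS (near_chart (chart_dom_open d) cp dp) => _ [q [cq dq] <-].
  by rewrite /= !chart_mapK.
have [_ dE] := near_eq_diff fE dcomp.
exact: etrans (dE v) compE.
Qed.

Lemma diff_transition_id c p v : chart_dom c p -> 'd (c \o chart_inv c) (c p) v = v.
Proof.
move=> cp; have idE : {near c p, id =1 c \o chart_inv c}.
  apply: filterS (near_chart openT cp I) => _ [q [cq _] <-].
  by rewrite /= chart_mapK.
have id_diff : differentiable (id : 'rV[R]_n -> 'rV[R]_n) (c p) by exact: ex_diff.
have [_ dE] := near_eq_diff idE id_diff.
by apply: etrans (dE v) _; rewrite diff_val.
Qed.

Lemma diff_transitionK c d p v : atlas c -> atlas d ->
  chart_dom c p -> chart_dom d p ->
  'd (c \o chart_inv d) (d p) ('d (d \o chart_inv c) (c p) v) = v.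
Proof.
move=> ac ad cp dp; apply: etrans (diff_transition_id v cp).
apply/esym; apply: diff_change_chart => //; exact: differentiable_transition.
Qed.

Lemma extendD p x y : extend p (x + y) = fun q : M => extend p x q + extend p y q.
Proof. by apply/funext => q; rewrite /extend /of_chart linearD. Qed.

Lemma extend_id p x : extend p x p = x.
Proof. exact: diff_transition_id (chart_at_dom p). Qed.

(** By the cocycle identity for transition maps the distinguished chart at q
    drops out, although the value of the field at q is stored in it. *)
Lemma local_rep_extend c p x q : atlas c -> chart_dom c q ->
  chart_dom (chart_at p) q ->
  local_rep c (extend p x) (c q) = 'D_x (c \o chart_inv (chart_at p)) (chart_at p q).
Proof.
move=> ac cq pq; rewrite /local_rep chart_mapK // /to_chart /extend /of_chart.
have [aq ap] := (chart_at_atlas q, chart_at_atlas p).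
have qq := chart_at_dom q.
have dpc : differentiable (c \o chart_inv (chart_at p)) (chart_at p q).
  exact: differentiable_transition.
have dqc : differentiable (c \o chart_inv (chart_at q)) (chart_at q q).
  exact: differentiable_transition.
apply: etrans (esym (diff_change_chart ap aq pq qq dqc x)) _.
exact: esym (deriveE x dpc).
Qed.

Lemma smooth_extend p x : smooth_vfield (chart_dom (chart_at p)) (extend p x).
Proof.
move=> c ac k; have ap := chart_at_atlas p.
set cp := chart_at p; set A := c @` _.
have Aopen : open A by exact/chart_image_open/chart_dom_open.
have transk : Ck_on k A (cp \o chart_inv c) by exact: atlas_smooth.
have [_ /(_ x) Dk] := atlas_smooth ap ac k.+1.
have compk : Ck_on k A ('D_x (c \o chart_inv cp) \o (cp \o chart_inv c)).
  apply: Ck_on_comp Dk transk => // _ [_ [q [cq pq] <-] <-].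
  by exists q => //=; rewrite chart_mapK.
apply: Ck_on_congr compk => // u; rewrite inE => -[q [cq pq] <-].
apply: etrans (esym (local_rep_extend x ac cq pq)).
by rewrite /comp chart_mapK.
Qed.

(** By [local_rep_extend] the components of the coordinate field of y, pulled
    back to the chart at p, are D_y of the transition map; pulling back also
    turns the value of the coordinate field of x into the constant x. *)
Lemma diff_local_rep_extend p x y q : chart_dom (chart_at p) q ->
  'd (local_rep (chart_at q) (extend p y)) (chart_at q q) (extend p x q) =
  'D_x ('D_y (chart_at q \o chart_inv (chart_at p))) (chart_at p q).
Proof.
move=> pq; have [aq ap] := (chart_at_atlas q, chart_at_atlas p).
have qq := chart_at_dom q.
set cp := chart_at p; set c := chart_at q.
set phi := c \o chart_inv cp; set H := local_rep c _.
have phia : phi (cp q) = c q by rewrite /phi /= chart_mapK.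
have dphi : differentiable phi (cp q) by exact: differentiable_transition.
have dH : differentiable H (c q).
  have [+ _] := smooth_extend p y aq 1%N; apply.
  by exists q.
have HE : {near cp q, H \o phi =1 'D_y phi}.
  apply: filterS (near_chart (chart_dom_open c) pq qq) => _ [r [pr qr] <-].
  by rewrite /H /phi /= !chart_mapK // local_rep_extend.
have [dcomp compE] := diff_compE x phia dphi dH.
have [dD DE] := near_eq_diff HE dcomp.
apply: etrans (esym compE) _; apply: etrans (esym (DE x)) _.
exact: esym (deriveE x dD).
Qed.

Lemma lie_bracket_extend p x y q : chart_dom (chart_at p) q ->
  lie_bracket (extend p x) (extend p y) q = 0.
Proof.
move=> pq; set phi := chart_at q \o chart_inv (chart_at p).
have Dopen := chart_image_open (c := chart_at p) (chart_dom_open (chart_at q)).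
have phi2 := atlas_smooth (chart_at_atlas p) (chart_at_atlas q) 2%N.
have Dq : (chart_at p @` (chart_dom (chart_at p) `&` chart_dom (chart_at q)))
    (chart_at p q).
  by exists q => //; split=> //; exact: chart_at_dom.
have DC : 'D_x ('D_y phi) (chart_at p q) = 'D_y ('D_x phi) (chart_at p q).
  exact: schwarz Dopen Dq phi2.
apply: etrans (congr2 (fun a b => a - b) (diff_local_rep_extend x y pq)
                                         (diff_local_rep_extend y x pq)) _.
apply: etrans (congr1 (fun a => a - _) DC) _; exact: subrr.
Qed.

(** Both f and the field are read in the distinguished chart at q; passing to
    the chart at p, the two transition differentials are inverse to each other
    and cancel. *)
Lemma lie_derive_extend (f : M -> R) p x q : chart_dom (chart_at p) q ->
  differentiable (f \o chart_inv (chart_at p)) (chart_at p q) ->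
  lie_derive (extend p x) f q = 'D_x (f \o chart_inv (chart_at p)) (chart_at p q).
Proof.
move=> pq df; have [aq ap] := (chart_at_atlas q, chart_at_atlas p).
have qq := chart_at_dom q.
apply: etrans (diff_change_chart aq ap qq pq df _) _.
apply: etrans _ (esym (deriveE x df)); congr ('d _ _ _).
exact: diff_transitionK.
Qed.

Lemma smooth_vfieldD U X Y : open U -> smooth_vfield U X -> smooth_vfield U Y ->
  smooth_vfield U (fun q => X q + Y q).
Proof.
move=> Uopen sX sY c ac k.
have /Ck_onD := sX c ac k; move=> /(_ _ (chart_image_open Uopen) (sY c ac k)).
congr (Ck_on _ _ _); apply/funext => u.
by rewrite /local_rep /to_chart linearD.
Qed.

Lemma smooth_vfield_eq0 U X : open U -> (forall q, U q -> X q = 0) ->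
  smooth_vfield U X.
Proof.
move=> Uopen X0 c ac k.
have cstk : Ck_on k (c @` (chart_dom c `&` U)) (fun=> 0 : 'rV[R]_n) by exact: Ck_on_cst.
apply: Ck_on_congr cstk; first exact: chart_image_open.
move=> u; rewrite inE => -[q [cq Uq] <-].
by rewrite /local_rep chart_mapK // X0 // /to_chart linear0.
Qed.

Lemma smooth_fun_indic U : open U -> smooth_fun U (\1_U : M -> R).
Proof.
move=> Uopen c ac k.
have cstk : Ck_on k (c @` (chart_dom c `&` U)) (fun=> 1 : R) by exact: Ck_on_cst.
apply: Ck_on_congr cstk; first exact: chart_image_open.
move=> u; rewrite inE => -[q [cq Uq] <-].
by rewrite /= chart_mapK // indicE mem_set.
Qed.

Lemma lie_derive_indic U X p : open U -> U p -> lie_derive X (\1_U : M -> R) p = 0.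
Proof.
move=> Uopen Up; rewrite /lie_derive; set c := chart_at p.
have cstE : {near c p, cst 1 =1 (\1_U : M -> R) \o chart_inv c}.
  apply: filterS (near_chart Uopen (chart_at_dom p) Up) => _ [q [cq Uq] <-].
  by rewrite /= chart_mapK // indicE mem_set.
have [_ dE] := near_eq_diff cstE (differentiable_cst (1 : R) (c p)).
by apply: etrans (dE _) _; rewrite diff_cst.
Qed.

End Charts.

(** * Algebraic curvature tensors *)

Section AlgebraicCurvature.
Variables (R : realFieldType) (V : Type).
Implicit Types (T : V -> V -> V -> V -> R) (r : V -> V).

Record curvature_like T : Prop := CurvatureLike {
  curvature_like_NC12 : forall x y z w, T x y z w = - T y x z w;
  curvature_like_NC34 : forall x y z w, T x y z w = - T x y w z;
  curvature_like_bianchi : forall x y z w,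
    T x y z w + T y z x w + T z x y w = 0
}.

Definition slides_through T r := forall x y z w,
  [/\ T (r x) y z w = T x (r y) z w, T x (r y) z w = T x y (r z) w &
      T x y (r z) w = T x y z (r w)].

(** When T is the curvature tensor of a metric, this is, as a form in x and w,
    twice the polarized Jacobi operator of y and z. *)
Definition polarization T x y z w := T x y z w + T x z y w.

Variables (T : V -> V -> V -> V -> R) (Tcurv : curvature_like T).

Lemma curvature_like_swap x y z w : T x y z w = T y x w z.
Proof.
by rewrite (curvature_like_NC12 Tcurv) (curvature_like_NC34 Tcurv) opprK.
Qed.

(** The octahedron argument: the four Bianchi identities obtained by singling
    out one of the vectors x, y, z, w involve six numbers up to the two
    antisymmetries, and an alternating sum leaves the two wanted ones. *)
Lemma curvature_like_pair x y z w : T x y z w = T z w x y.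
Proof.
have swap := curvature_like_swap; have bianchi := curvature_like_bianchi Tcurv.
have := bianchi x y z w; have := bianchi y x w z.
have := bianchi z w x y; have := bianchi w z y x.
rewrite (swap w z y x) (swap z y w x) (swap w x z y) (swap x z w y).
rewrite (swap y x w z) (swap w y x z); lra.
Qed.

(** Put r on each of the four vectors in turn in the Bianchi identity of
    x, y, z with w.  By the hypothesis and its image under pair symmetry, each
    cyclic term takes only two values a, a', b, b', c, c', according to whether
    r sits in its first or in its second pair; the four identities are
    a + b' + c = 0, a + b + c' = 0, a' + b + c = 0 and a' + b' + c' = 0, and
    they force a = a'. *)
Lemma slides_through_skew r :
  (forall x y z w, T x y (r z) w = T x y z (r w)) -> slides_through T r.
Proof.
move=> skew; have pair := curvature_like_pair.
have skew12 x y z w : T (r x) y z w = T x (r y) z w.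
  by rewrite pair skew pair.
have bianchi := curvature_like_bianchi Tcurv.
move=> x y z w; split=> //.
have := bianchi (r x) y z w; have := bianchi x (r y) z w.
have := bianchi x y (r z) w; have := bianchi x y z (r w).
rewrite !skew12 !skew; lra.
Qed.

Local Notation K := (polarization T).

Lemma polarization_pair x y z w : K x y z w = K y x w z.
Proof.
rewrite /polarization curvature_like_swap (curvature_like_pair x z).
by rewrite (curvature_like_swap y w).
Qed.

Lemma polarization_cyclic x y z w : K x y z w + K x z w y + K x y w z = 0.
Proof.
rewrite /polarization; have := curvature_like_NC34 Tcurv.
move=> NC34; rewrite (NC34 x z w y) (NC34 x y w z) (NC34 x w z y); ring.
Qed.

Lemma polarization_determines x y z w : T x y z w *+ 3 = K x y z w - K x y w z.
Proof.
rewrite /polarization (curvature_like_NC34 Tcurv x y w z) (curvature_like_pair x w).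
have := curvature_like_bianchi Tcurv x y z w.
rewrite (curvature_like_NC12 Tcurv z x); lra.
Qed.

(** Four vectors split into pairs in three ways, so K has three values when r is
    put on a given vector, and they add up to 0.  The hypothesis and the pair
    symmetry say that the value for a splitting is the same for r on either
    member of a pair, which leaves a, a', c, c', e, e' and the relations
    a + c + e = a' + c + e' = a' + c' + e = a + c' + e' = 0.  Hence a = a' and
    e = e', and T is recovered from K. *)
Lemma slides_through_jacobi r :
  (forall x y z w, K (r x) y z w = K x y z (r w)) -> slides_through T r.
Proof.
move=> jac; apply: slides_through_skew => z w x y.
rewrite curvature_like_pair [RHS]curvature_like_pair.
have pair := polarization_pair.
have a_yz : K x (r y) z w = K x y (r z) w by rewrite pair jac pair.
have c_zw : K x (r z) w y = K x z (r w) y by rewrite pair jac pair.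
have e_yw : K x (r y) w z = K x y (r w) z by rewrite pair jac pair.
have := polarization_cyclic (r x) y z w; have := polarization_cyclic x (r y) z w.
have := polarization_cyclic x y (r z) w; have := polarization_cyclic x y z (r w).
have := polarization_determines (r x) y z w.
have := polarization_determines x (r y) z w.
rewrite -!jac a_yz c_zw e_yw !mulrS; lra.
Qed.

End AlgebraicCurvature.

(** * Locality of connections *)

Section Connection.
Local Open Scope classical_set_scope.
Variables (R : realType) (n : nat) (M : manifold R n).
Variables (nabla : vfield M -> vfield M -> vfield M) (Hn : is_connection nabla).
Implicit Types (U : set M) (X Y : vfield M).

Lemma indic_scale_eq U X X' : (forall q, U q -> X q = X' q) ->
  (fun q => (\1_U q : R) *: X q) = (fun q => (\1_U q : R) *: X' q).
Proof.
move=> XX'; apply/funext => q; rewrite indicE.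
by have [/set_mem/XX' ->//|_] := boolP (q \in U); rewrite !scale0r.
Qed.

(** Multiplying by the indicator function of U, which is smooth on U, erases
    the difference between two fields that agree on U; by the Leibniz-type
    rules it does not change the value of nabla in U. *)
Lemma nabla_locall U X X' Y p : open U -> smooth_vfield U X ->
  smooth_vfield U X' -> smooth_vfield U Y -> (forall q, U q -> X q = X' q) ->
  U p -> nabla X Y p = nabla X' Y p.
Proof.
move=> Uopen sX sX' sY XX' Up.
have cut Z : smooth_vfield U Z ->
    nabla (fun q => (\1_U q : R) *: Z q) Y p = nabla Z Y p.
  move=> sZ; rewrite (nablaZl Hn Uopen (smooth_fun_indic Uopen) sZ sY Up).
  by rewrite indicE mem_set // scale1r.
by rewrite -(cut _ sX) -(cut _ sX') (indic_scale_eq XX').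
Qed.

Lemma nabla_localr U X Y Y' p : open U -> smooth_vfield U X ->
  smooth_vfield U Y -> smooth_vfield U Y' -> (forall q, U q -> Y q = Y' q) ->
  U p -> nabla X Y p = nabla X Y' p.
Proof.
move=> Uopen sX sY sY' YY' Up.
have cut Z : smooth_vfield U Z ->
    nabla X (fun q => (\1_U q : R) *: Z q) p = nabla X Z p.
  move=> sZ; rewrite (nabla_Leibniz Hn Uopen (smooth_fun_indic Uopen) sX sZ Up).
  by rewrite lie_derive_indic // indicE mem_set // scale1r scale0r add0r.
by rewrite -(cut _ sY) -(cut _ sY') (indic_scale_eq YY').
Qed.

(** Additivity alone is enough, since X + X agrees with X on U. *)
Lemma nabla_eq0 U X Y p : open U -> (forall q, U q -> X q = 0) ->
  smooth_vfield U Y -> U p -> nabla X Y p = 0.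
Proof.
move=> Uopen X0 sY Up; have sX := smooth_vfield_eq0 Uopen X0.
have s0 : smooth_vfield U (fun q => X q + X q) by exact: smooth_vfieldD.
have E : nabla (fun q => X q + X q) Y p = nabla X Y p.
  by apply: (nabla_locall Uopen) => // q Uq; rewrite X0 // addr0.
move: E; rewrite (nablaDl Hn Uopen sX sX sY Up) => /eqP.
by rewrite -subr_eq0 addrK => /eqP.
Qed.

End Connection.

(** * Symmetries of the curvature tensor *)

Section Curvature.
Local Open Scope classical_set_scope.
Variables (R : realType) (n : nat) (M : pseudo_riemannian R n).
Variables (nabla : vfield M -> vfield M -> vfield M) (LC : is_levi_civita nabla).
Implicit Types (p q : M) (x y z w : 'rV[R]_n).

Let nablaC := lc_connection LC.
Local Notation U p := (chart_dom (chart_at p)).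
Let Uopen p : open (U p) := chart_dom_open (chart_at p).
Let Up p : U p p := chart_at_dom p.
Let smoothE p x : smooth_vfield (U p) (extend p x) := smooth_extend p x.

Lemma smooth_nabla p X Y : smooth_vfield (U p) X -> smooth_vfield (U p) Y ->
  smooth_vfield (U p) (nabla X Y).
Proof. exact: (nabla_smooth nablaC (Uopen p)). Qed.

(** Coordinate fields commute, so the bracket term of the curvature drops. *)
Lemma curvature_opE p x y z : curvature_op nabla p x y z =
  nabla (extend p x) (nabla (extend p y) (extend p z)) p -
  nabla (extend p y) (nabla (extend p x) (extend p z)) p.
Proof.
rewrite /curvature_op /curvature_vfield.
rewrite (nabla_eq0 nablaC (Uopen p) _ (smoothE p z) (Up p)) ?subr0 //.
exact: lie_bracket_extend.
Qed.

Lemma nabla_extendC p x y q : U p q ->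
  nabla (extend p x) (extend p y) q = nabla (extend p y) (extend p x) q.
Proof.
move=> Uq; apply/eqP; rewrite -subr_eq0; apply/eqP.
rewrite (lc_torsion_free LC (Uopen p) (smoothE p x) (smoothE p y) Uq).
exact: lie_bracket_extend.
Qed.

Lemma curvature_opNC p x y z :
  curvature_op nabla p x y z = - curvature_op nabla p y x z.
Proof. by rewrite !curvature_opE opprB. Qed.

Lemma curvature_op_bianchi p x y z : curvature_op nabla p x y z +
  curvature_op nabla p y z x + curvature_op nabla p z x y = 0.
Proof.
have C u v w : nabla (extend p u) (nabla (extend p v) (extend p w)) p =
               nabla (extend p u) (nabla (extend p w) (extend p v)) p.
  apply: (nabla_localr nablaC (Uopen p)) => //; try exact: smooth_nabla.
  by move=> q Uq; exact: nabla_extendC.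
rewrite !curvature_opE (C x z y) (C y x z) (C z y x).
by rewrite !addrA !subrK subrr.
Qed.

Lemma curvature_opDl p x x' y z : curvature_op nabla p (x + x') y z =
  curvature_op nabla p x y z + curvature_op nabla p x' y z.
Proof.
have outer : nabla (extend p (x + x')) (nabla (extend p y) (extend p z)) p =
    nabla (extend p x) (nabla (extend p y) (extend p z)) p +
    nabla (extend p x') (nabla (extend p y) (extend p z)) p.
  by rewrite extendD (nablaDl nablaC (Uopen p)) //; exact: smooth_nabla.
have inner : nabla (extend p y) (nabla (extend p (x + x')) (extend p z)) p =
    nabla (extend p y) (nabla (extend p x) (extend p z)) p +
    nabla (extend p y) (nabla (extend p x') (extend p z)) p.
  rewrite -(nablaDr nablaC (Uopen p)) //; try exact: smooth_nabla.
  rewrite extendD; apply: (nabla_localr nablaC (Uopen p)) => //.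
  - by apply: smooth_nabla => //; exact: smooth_vfieldD.
  - by apply: smooth_vfieldD => //; exact: smooth_nabla.
  - by move=> q Uq; exact: (nablaDl nablaC (Uopen p)).
by rewrite !curvature_opE outer inner opprD addrACA.
Qed.

Lemma curvature_opDr p x y z z' : curvature_op nabla p x y (z + z') =
  curvature_op nabla p x y z + curvature_op nabla p x y z'.
Proof.
have D u v : nabla (extend p u) (nabla (extend p v) (extend p (z + z'))) p =
    nabla (extend p u) (nabla (extend p v) (extend p z)) p +
    nabla (extend p u) (nabla (extend p v) (extend p z')) p.
  rewrite -(nablaDr nablaC (Uopen p)) //; try exact: smooth_nabla.
  rewrite extendD; apply: (nabla_localr nablaC (Uopen p)) => //.
  - by apply: smooth_nabla => //; exact: smooth_vfieldD.
  - by apply: smooth_vfieldD => //; exact: smooth_nabla.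
  - by move=> q Uq; exact: (nablaDr nablaC (Uopen p)).
by rewrite !curvature_opE !D opprD addrACA.
Qed.

Lemma metricDl p x x' y : metric p (x + x') y = metric p x y + metric p x' y.
Proof. by rewrite /metric !mulmxDl mxE. Qed.

Lemma metricNl p x y : metric p (- x) y = - metric p x y.
Proof. by rewrite /metric !mulNmx mxE. Qed.

Lemma metricC p x y : metric p x y = metric p y x.
Proof.
rewrite /metric -[in LHS](trmxK (_ *m _^T)) mxE.
by rewrite !trmx_mul trmxK gram_sym mulmxA.
Qed.

Lemma metricDr p x y y' : metric p x (y + y') = metric p x y + metric p x y'.
Proof. by rewrite !(metricC p x) metricDl. Qed.

Lemma metric_inj p x y : (forall w, metric p x w = metric p y w) -> x = y.
Proof.
move=> xy; suff: x *m gram p = y *m gram p.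
  by move/(congr1 (mulmx^~ (invmx (gram p)))); rewrite !mulmxK // gram_nondegenerate.
apply/rowP => i; have := xy (delta_mx 0 i).
by rewrite /metric trmx_delta -!colE !mxE.
Qed.

(** Let F be g(Z, Z) in the chart at p.  By compatibility with the metric, half
    of D_u D_v F is g(nabla_U nabla_V Z, Z) + g(nabla_V Z, nabla_U Z).  The left
    side and the second term are symmetric in u and v, hence so is the first
    term, which says that R(u, v, z, z) = 0. *)
Lemma curvature_alternating p x y z : curvature nabla p x y z z = 0.
Proof.
set Z := extend p z; set cp := chart_at p.
pose F u := metric (chart_inv cp u) (Z (chart_inv cp u)) (Z (chart_inv cp u)).
have sF : smooth_on (cp @` chart_dom cp) F.
  exact: (gram_smooth (chart_at_atlas p) z z).
have dF u : (cp @` chart_dom cp) u -> differentiable F u.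
  by have [+ _] := sF 1%N; apply.
have Fopen : open (cp @` chart_dom cp) by exact: chart_cod_open.
have Fp : (cp @` chart_dom cp) (cp p) by exists p => //; exact: Up.
have half v q : U p q ->
    metric q (nabla (extend p v) Z q) (Z q) = 2^-1 * 'D_v F (cp q).
  move=> Uq; have dFq : differentiable F (cp q) by apply: dF; exists q.
  have := lc_metric LC (Uopen p) (smoothE p v) (smoothE p z) (smoothE p z) Uq.
  rewrite (lie_derive_extend v Uq dFq) => ->.
  by rewrite (metricC q (extend p z q)) -/Z; lra.
have second u v : metric p (nabla (extend p u) (nabla (extend p v) Z) p) z +
    metric p (nabla (extend p v) Z p) (nabla (extend p u) Z p) =
    2^-1 * 'D_u ('D_v F) (cp p).
  have sVZ := smooth_nabla (smoothE p v) (smoothE p z).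
  have := lc_metric LC (Uopen p) (smoothE p u) sVZ (smoothE p z) (Up p).
  rewrite extend_id => <-.
  set h := fun q => _.
  have dDv : differentiable ('D_v F) (cp p).
    by have [_ /(_ v)[+ _]] := sF 2%N; apply.
  have hE : {near cp p, (fun w => 2^-1 *: 'D_v F w) =1 h \o chart_inv cp}.
    apply: filterS (open_nbhs_nbhs (conj Fopen Fp)) => _ [q Uq <-].
    by rewrite /h /= chart_mapK // half.
  have dh2 : differentiable (fun w => 2^-1 *: 'D_v F w) (cp p).
    exact: differentiableZ.
  have [dh _] := near_eq_diff hE dh2.
  apply: etrans (lie_derive_extend u (Up p) dh) _.
  apply: etrans (esym (near_eq_derive u hE)) _.
  by rewrite deriveZ //; exact: diff_derivable.
have DC : 'D_x ('D_y F) (cp p) = 'D_y ('D_x F) (cp p).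
  exact: schwarz_scalar Fopen Fp (sF 2%N).
have S := etrans (second x y)
  (etrans (congr1 (fun r => 2^-1 * r) DC) (esym (second y x))).
rewrite /curvature curvature_opE metricDl metricNl -/Z.
rewrite (metricC p (nabla (extend p x) Z p)) in S.
by move/addIr: S => ->; rewrite subrr.
Qed.

Lemma curvatureNC12 p x y z w : curvature nabla p x y z w = - curvature nabla p y x z w.
Proof. by rewrite /curvature curvature_opNC metricNl. Qed.

Lemma curvature_bianchi p x y z w : curvature nabla p x y z w +
  curvature nabla p y z x w + curvature nabla p z x y w = 0.
Proof.
by rewrite /curvature -!metricDl curvature_op_bianchi /metric !mul0mx mxE.
Qed.

Lemma curvatureNC34 p x y z w : curvature nabla p x y z w = - curvature nabla p x y w z.
Proof.
have := curvature_alternating p x y (z + w).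
rewrite /curvature curvature_opDr metricDl !metricDr.
have := curvature_alternating p x y z; have := curvature_alternating p x y w.
rewrite /curvature; lra.
Qed.

Lemma curvature_likeP p : curvature_like (curvature nabla p).
Proof.
split; [exact: curvatureNC12|exact: curvatureNC34|exact: curvature_bianchi].
Qed.

Lemma curvatureDl p x x' y z w : curvature nabla p (x + x') y z w =
  curvature nabla p x y z w + curvature nabla p x' y z w.
Proof. by rewrite /curvature curvature_opDl metricDl. Qed.

Lemma curvatureDm p x y y' z w : curvature nabla p x (y + y') z w =
  curvature nabla p x y z w + curvature nabla p x y' z w.
Proof.
by rewrite !(curvatureNC12 p x) curvatureDl opprD.
Qed.

Lemma curvatureDr p x y z z' w : curvature nabla p x y (z + z') w =
  curvature nabla p x y z w + curvature nabla p x y z' w.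
Proof. by rewrite /curvature curvature_opDr metricDl. Qed.

End Curvature.

(** * Commutation with the Ricci operator *)

Section RicciOperator.
Variables (R : realType) (n : nat) (M : pseudo_riemannian R n).
Variables (nabla : vfield M -> vfield M -> vfield M).
Variables (rho : M -> {linear 'rV[R]_n -> 'rV[R]_n}).

Lemma ricci_formC (p : M) x y : ricci_form nabla p x y = ricci_form nabla p y x.
Proof.
congr (\tr (lin1_mx _)); apply/funext => z.
by rewrite /polarized_jacobi_op addrC.
Qed.

Hypothesis rho_ricci : is_ricci_operator nabla rho.

Lemma ricci_self_adjoint (p : M) x y : metric p (rho p x) y = metric p x (rho p y).
Proof. by rewrite rho_ricci ricci_formC -rho_ricci metricC. Qed.

Lemma skew_videvP : skew_videv nabla rho <-> forall (p : M) x y z w,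
  curvature nabla p x y (rho p z) w = curvature nabla p x y z (rho p w).
Proof.
split=> [skew p x y z w|skew p x y z].
  by rewrite /curvature skew ricci_self_adjoint.
by apply: (@metric_inj _ _ _ p) => w; rewrite ricci_self_adjoint; exact: skew.
Qed.

Lemma jacobi_videvP : jacobi_videv nabla rho <-> forall (p : M) x y w,
  curvature nabla p (rho p y) x x w = curvature nabla p y x x (rho p w).
Proof.
split=> [jac p x y w|jac p x y].
  by rewrite /curvature -[curvature_op _ _ _ _ _]/(jacobi_op nabla p x (rho p y)) jac
             ricci_self_adjoint.
by apply: (@metric_inj _ _ _ p) => w; rewrite ricci_self_adjoint; exact: jac.
Qed.

End RicciOperator.

Theorem theorem1p5 (R : realType) (n : nat) (M : pseudo_riemannian R n)
    (nabla : vfield M -> vfield M -> vfield M)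
    (nabla_lc : is_levi_civita nabla)
    (rho : M -> {linear 'rV[R]_n -> 'rV[R]_n})
    (rho_ricci : is_ricci_operator nabla rho) :
  [<-> (forall (P : M) (x1 x2 x3 x4 : 'rV[R]_n),
          [/\ curvature nabla P (rho P x1) x2 x3 x4 =
              curvature nabla P x1 (rho P x2) x3 x4,
              curvature nabla P x1 (rho P x2) x3 x4 =
              curvature nabla P x1 x2 (rho P x3) x4 &
              curvature nabla P x1 x2 (rho P x3) x4 =
              curvature nabla P x1 x2 x3 (rho P x4)]);
       skew_videv nabla rho;
       jacobi_videv nabla rho].
Proof.
have curv := curvature_likeP nabla_lc.
tfae.
- move=> slides; apply/(skew_videvP rho_ricci) => p x y z w.
  by have [] := slides p x y z w.
- move/(skew_videvP rho_ricci) => skew.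
  apply/(jacobi_videvP rho_ricci) => p x y w.
  by have [-> -> ->] := slides_through_skew (curv p) (skew p) y x x w.
- move/(jacobi_videvP rho_ricci) => jac p.
  apply: (slides_through_jacobi (curv p)) => x y z w.
  (* jac at y + z minus its instances at y and at z *)
  have := jac p (y + z) x w.
  rewrite !(curvatureDm nabla_lc) !(curvatureDr nabla_lc) !jac /polarization; lra.
Qed.
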